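(* Let $k\geq 1$ be a natural number. Suppose that $X$ and $Y$ are non-empty compact spaces. If $X$ is a Fréchet space, $\partial\Delta^k\text{-}\mathrm{str}\,X=1$, and $\partial\Delta^k\text{-}\mathrm{Ind}\,X=\partial\Delta^k\text{-}\mathrm{Ind}\,Y$, then $$\partial\Delta^k\text{-}\mathrm{Ind}\,Z(X,Y)=\partial\Delta^k\text{-}\mathrm{Ind}\,X+1.$$
   Context: All spaces are $T_1$ and completely regular (so compact spaces are Hausdorff). A space is Fréchet if, whenever $x\in\mathrm{cl}\,A$, some sequence in $A$ converges to $x$. $\Delta^k$ is the $k$-dimensional simplex with vertices $e_0,\dots,e_k$; $K=\partial\Delta^k$ is the simplicial complex of all its faces of dimension at most $k-1$. $K$-tuples. For $K=\partial\Delta^k$, a $K$-tuple of a space $X$ is a $(k+1)$-tuple $\mathcal A=(A_0,\dots,A_k)$ of subsets of $X$ with $\bigcap_{i=0}^kA_i=\emptyset$. It is open (closed) if all $A_i$ are. $\bigcup\mathcal A=\bigcup_iA_i$. If $\mathcal A$ is an open $K$-tuple and $B_i\subset A_i$ for all $i$, then $\mathcal A$ is a $K$-neighbourhood of $\mathcal B=(B_0,\dots,B_k)$ and $P=X\setminus\bigcup\mathcal A$ is a $K$-partition for $\mathcal B$. $K\text{-}\mathrm{Ind}$ (normal $X$; values: ordinals, $-1$, $\infty$): $K\text{-}\mathrm{Ind}\,X=-1$ iff $X=\emptyset$; for an ordinal $\alpha$, $K\text{-}\mathrm{Ind}\,X\le\alpha$ iff every closed $K$-tuple of $X$ has a $K$-partition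 $P$ with $K\text{-}\mathrm{Ind}\,P<\alpha$; for $X\neq\emptyset$ the value is the least such ordinal $\alpha$, or $\infty$ if none. Obstruction points and strength degree. For an open $K$-tuple $\mathcal U$ of $X$, $K\text{-}\mathrm{obs}\,\mathcal U$ is the set of points $x\in X$ such that $\mathcal U$ has no $K$-neighbourhood $\mathcal V$ with $x\in\bigcup\mathcal V$. $K\text{-}\mathrm{str}\,X\in\{0,1\}$: if $\alpha=K\text{-}\mathrm{Ind}\,X\in\{-1,0,\infty\}$, then $K\text{-}\mathrm{str}\,X=0$. If $0<\alpha<\infty$, then $K\text{-}\mathrm{str}\,X=0$ when every closed $K$-tuple of $X$ has a $K$-neighbourhood $\mathcal U$ with $K\text{-}\mathrm{obs}\,\mathcal U=\emptyset$ and $K\text{-}\mathrm{Ind}(X\setminus\bigcup\mathcal U)<\alpha$, and $K\text{-}\mathrm{str}\,X=1$ otherwise. The space $Z(X,Y)$ for non-empty compact $X,Y$. $A_{\mathfrak m}$ is the one-point compactification of the discrete space of cardinality $\mathfrak m$, and $\mu$ is its unique non-isolated point. $\mathcal S_X$ is the family of all subsets of $X$ that are finite (possibly empty) or homeomorphic to $A_{\aleph_0}$. Fix a cardinal $\mathfrak m\ge\max\{\aleph_0,(wX)^+,(wY)^+,\mathrm{card}\,\mathcal S_X\}$ ($w$ = weight) and a function $\varphi\colon A_{\mathfrak m}\setminus\{\mu\}\to\mathcal S_X$ with $\mathrm{card}\,\varphi^{-1}(S)=\mathfrak m$ for every $S\in\mathcal S_X$. Let $\pi_1\colon A_{\mathfrak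 m}\times X\times Y\to N$ be the quotient map collapsing each set $\{\mu\}\times\{x\}\times Y$, $x\in X$, to a point. Put $H(\mu)=\pi_1(\{\mu\}\times X\times Y)$, $H(\alpha)=\pi_1(\{\alpha\}\times\varphi(\alpha)\times Y)$ for $\alpha\ne\mu$, and $Z(X,Y)=\bigcup_{\alpha\in A_{\mathfrak m}}H(\alpha)\subset N$. The choices of $\mathfrak m$ and $\varphi$ are arbitrary. *)

(* Defs.v *)
From HB Require Import structures.
From mathcomp Require Import all_boot generic_quotient.
From mathcomp Require Import all_classical topology.

Set Implicit Arguments.
Unset Strict Implicit.
Unset Printing Implicit Defensive.

Local Open Scope classical_set_scope.
Local Open Scope card_scope.
Local Open Scope quotient_scope.

(* Ordinals are represented by well-founded trees: [osup f] stands for the least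
   ordinal strictly above all the [f i]. Different trees may represent the same
   ordinal, so ordinals are compared with [ole], [olt] and [oeq], never with
   Leibniz equality. *)
Inductive Ord : Type := osup (I : Type) (f : I -> Ord).

Fixpoint ole (a b : Ord) : Prop :=
  match a, b with osup _ f, osup _ g => forall i, exists j, ole (f i) (g j) end.

Definition olt (a b : Ord) : Prop :=
  match b with osup _ g => exists j, ole a (g j) end.

Definition oeq (a b : Ord) : Prop := ole a b /\ ole b a.

Definition ozero : Ord := osup (of_void Ord).

Definition osucc (a : Ord) : Ord := osup (fun _ : unit => a).

Lemma ole_refl a : ole a a.
Proof. by elim: a => I f IH /= i; exists i. Qed.

Lemma ole_trans b a c : ole a b -> ole b c -> ole a c.
Proof.
elim: a b c => I f IH [J g] [L h] /= fg gh i.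
have [j fgj] := fg i; have [l ghl] := gh j.
by exists l; exact: IH fgj ghl.
Qed.

Lemma ole_lt_trans b a c : ole a b -> olt b c -> olt a c.
Proof. by case: c => L h ab [l bl]; exists l; exact: ole_trans ab bl. Qed.

Lemma olt_le_trans b a c : olt a b -> ole b c -> olt a c.
Proof.
case: b c => [J g] [L h] [j aj] gh; have [l gl] := gh j.
by exists l; exact: ole_trans aj gl.
Qed.

Lemma olt_wf : well_founded olt.
Proof.
suff H a b : ole b a -> Acc olt b by move=> a; exact: H (ole_refl a).
elim: a b => I f IH b ba; constructor => c cb.
by have [i cf] := olt_le_trans cb ba; exact: IH cf.
Qed.

Lemma olt_irr a : ~ olt a a.
Proof. by elim: (olt_wf a) => {}a _ IH aa; exact: (IH a). Qed.

Lemma ole_total a b : ole a b \/ olt b a.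
Proof.
elim: a b => I f IH [J g].
have [fg|/existsNP[i fgi]] := pselect (forall i, exists j, ole (f i) (g j)).
  by left.
right; exists i; case: (f i) (IH i) fgi => L h IHi fgi j.
by have [?|//] := IHi (g j); case: fgi; exists j.
Qed.

Lemma oltNge a b : olt a b <-> ~ ole b a.
Proof.
split=> [ab ba|]; first exact: (olt_irr (olt_le_trans ab ba)).
by have [|//] := ole_total b a.
Qed.

Lemma osup_least (P : Ord -> Prop) :
  (exists a, P a) -> exists a, P a /\ forall b, P b -> ole a b.
Proof.
case=> a; elim: (olt_wf a) => {}a _ IH Pa.
have [//|/existsNP[b /not_implyP[Pb ab]]] := pselect (forall b, P b -> ole a b).
  by exists a.
by apply: (IH b) => //; apply/oltNge.
Qed.

Section Ktuples.
Variables (k : nat) (X : topologicalType).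
Implicit Types A B U V : 'I_k.+1 -> set X.

Definition Ktuple A : Prop := \bigcap_i A i = set0.

Definition closed_Ktuple A : Prop := Ktuple A /\ forall i, closed (A i).

Definition open_Ktuple A : Prop := Ktuple A /\ forall i, open (A i).

Definition Knbhd B U : Prop := open_Ktuple U /\ forall i, B i `<=` U i.

Definition Kpartition B (P : set X) : Prop :=
  exists2 U, Knbhd B U & P = ~` \bigcup_i U i.

Definition Kobs U : set X :=
  [set x | ~ exists2 V, Knbhd U V & (\bigcup_i V i) x].

End Ktuples.

(* [KInd_le k X a] states that the K-Ind of [X], for K the boundary of the
   k-simplex, is at most the ordinal [a]; subsets carry the subspace topology. *)
Inductive KInd_le (k : nat) : topologicalType -> Ord -> Prop :=
  KInd_leI (X : topologicalType) (a : Ord) :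
    (forall A : 'I_k.+1 -> set X, closed_Ktuple A ->
      exists2 P : set X, Kpartition A P &
        P = set0 \/ exists2 b, olt b a & KInd_le k (set_type P) b) ->
    KInd_le k X a.

Inductive dim : Type := DimN1 | DimOrd of Ord | DimInfty.

Definition dim_lt (d : dim) (a : Ord) : Prop :=
  match d with DimN1 => True | DimOrd b => olt b a | DimInfty => False end.

Definition dim_eq (d e : dim) : Prop :=
  match d, e with
  | DimN1, DimN1 | DimInfty, DimInfty => True
  | DimOrd a, DimOrd b => oeq a b
  | _, _ => False
  end.

Definition dim_succ (d : dim) : dim :=
  match d with
  | DimN1 => DimOrd ozero
  | DimOrd a => DimOrd (osucc a)
  | DimInfty => DimInfty
  end.

Definition KInd (k : nat) (X : topologicalType) : dim :=
  if pselect ([set: X] = set0) then DimN1 else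
  match pselect (exists a, KInd_le k X a /\
                   forall b, KInd_le k X b -> ole a b) with
  | left h => DimOrd (projT1 (cid h))
  | right _ => DimInfty
  end.

Lemma dim_lt_KInd k X a : dim_lt (KInd k X) a <->
  [set: X] = set0 \/ exists2 b, olt b a & KInd_le k X b.
Proof.
rewrite /KInd; case: pselect => [X0|nX0]; first by split => // _; left.
case: pselect => [h|nh] /=.
  case: cid => b [Xb minb] /=; split=> [ba|]; first by right; exists b.
  by case=> // -[c ca Xc]; apply: ole_lt_trans ca; exact: minb.
split=> // -[//|[b ba Xb]].
by apply: nh; apply: osup_least; exists b.
Qed.

(* The defining property of K-Ind, in terms of its values. *)
Lemma KInd_leP k X a : KInd_le k X a <->
  forall A : 'I_k.+1 -> set X, closed_Ktuple A ->
    exists2 P : set X, Kpartition A P & dim_lt (KInd k (set_type P)) a.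
Proof.
have PE (Y : topologicalType) (P : set Y) : [set: set_type P] = set0 <-> P = set0.
  split=> [P0|->]; rewrite -subset0; last by case=> x xP _; have := set_mem xP.
  move=> x Px; suff : [set: set_type P] (SigSub (mem_set Px)) by rewrite P0.
  by [].
split=> [[{}X {}a H] A /H[P AP HP]|H].
  by exists P => //; apply/dim_lt_KInd; case: HP => [/PE|]; [left|right].
constructor=> A /H[P AP /dim_lt_KInd HP].
by exists P => //; case: HP => [/PE|]; [left|right].
Qed.

Definition KStr (k : nat) (X : topologicalType) : nat :=
  match KInd k X with
  | DimN1 | DimInfty => 0
  | DimOrd a =>
    if `[< oeq a ozero >] then 0 else
    if `[< forall A : 'I_k.+1 -> set X, closed_Ktuple A ->
             exists U, [/\ Knbhd A U, Kobs U = set0 &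
               dim_lt (KInd k (set_type (~` \bigcup_i U i))) a] >] then 0
    else 1
  end.

Definition Frechet (X : topologicalType) : Prop :=
  forall (A : set X) x, closure A x ->
    exists2 u : nat -> X, (forall n, A (u n)) & u @ \oo --> x.

Definition homeomorphic (X Y : topologicalType) : Prop :=
  exists (f : X -> Y) (g : Y -> X),
    [/\ continuous f, continuous g, cancel f g & cancel g f].

(* The one-point compactification of the discrete space [M]; its point at
   infinity is [None]. *)
Definition Acpt (M : choiceType) : Type :=
  one_point_compactification (discrete_topology M).

HB.instance Definition _ (M : choiceType) := Topological.on (Acpt M).

Definition SX (X : topologicalType) : set (set X) :=
  [set S | finite_set S \/ homeomorphic (set_type S) (Acpt nat)].
Arguments SX : clear implicits.

(* [weight_lt X M] states that w X is less than card M, that is, that the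
   cardinal successor of w X is at most card M. *)
Definition weight_lt (X : topologicalType) (M : Type) : Prop :=
  exists2 B : set (set X), basis B & ~ ([set: M] #<= B).

(* The requirements on the parameters m = card M and phi of Z(X, Y). *)
Record Z_parameters (X Y : topologicalType) (M : choiceType)
    (phi : M -> set X) : Prop := {
  Z_infinite : [set: nat] #<= [set: M];
  Z_weightX : weight_lt X M;
  Z_weightY : weight_lt Y M;
  Z_cardSX : SX X #<= [set: M];
  Z_phiSX : forall m, SX X (phi m);
  Z_fibers : forall S, SX X S -> phi @^-1` [set S] #= [set: M] }.

Section Z.
Variables (X Y : topologicalType) (M : choiceType) (phi : M -> set X).

Definition Zprod : topologicalType := (Acpt M * X * Y)%type.

Definition Zcollapse (p q : Zprod) : bool :=
  `[< p = q \/ [/\ p.1.1 = None, q.1.1 = None & p.1.2 = q.1.2] >].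

Lemma Zcollapse_equiv : equiv_class_of Zcollapse.
Proof.
split=> [p|p q|q p r].
- by apply/asboolP; left.
- by apply/asboolP/asboolP => -[->|[? ? ?]]; (try by left); right.
- move=> /asboolP[->//|[p0 q0 pq]] /asboolP[<-|[_ r0 qr]]; apply/asboolP; right.
    by split.
  by split=> //; rewrite pq.
Qed.

Canonical Zcollapse_equiv_rel := EquivRelPack Zcollapse_equiv.

Definition ZN : topologicalType := quotient_topology {eq_quot Zcollapse}.

Definition Zpi (p : Zprod) : ZN := \pi_{eq_quot Zcollapse} p.

Definition Zslice (a : Acpt M) : set ZN :=
  match a with
  | None => Zpi @` [set p | p.1.1 = None]
  | Some m => Zpi @` [set p | p.1.1 = Some m /\ phi m p.1.2]
  end.

Definition Zspace : topologicalType := set_type (\bigcup_a Zslice a).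

End Z.

(* Main.v *)
Require Import Defs.
From mathcomp Require Import all_boot generic_quotient.
From mathcomp Require Import all_classical topology.

Set Implicit Arguments.
Unset Strict Implicit.
Unset Printing Implicit Defensive.

Local Open Scope classical_set_scope.

(** Put [K] for the boundary of the k-simplex and let alpha be the common
value of K-Ind X and K-Ind Y. In Z(X, Y) the slice H(mu) is a copy of [X], and
every other slice H(m) is clopen and homeomorphic to [phi m] x [Y], where [phi
m] is a finite set or a convergent sequence.

Upper bound. Restrict a closed K-tuple of Z to H(mu) = X and take there a
K-neighbourhood U whose K-partition Q satisfies K-Ind Q < alpha. Spread the
sets U_i constantly over the slices. By compactness this works off a finite
set of slices, and on those K-Ind (phi m x Y) <= alpha [fKInd_le_box] gives
partitions of their own. The trace on another slice leaves (phi m & Q) x Y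
uncovered, but every point of [phi m & Q] isolated in [phi m] can be added to
U_0: as k >= 1, it lies outside U_1, so the intersection stays empty. The
partition obtained consists of Q and of at most one copy of [Y] in each slice.
The same argument [fKInd_le_bundle] applied to that set, where now all the
points to be covered are isolated, shows that its K-Ind is at most alpha
[fKInd_le_bundle1]. Hence K-Ind Z <= alpha + 1 [fKInd_Z_upper].

Lower bound. Since K-str X = 1, some closed K-tuple of X has the property that
every K-neighbourhood with a partition of K-Ind < alpha has an obstruction
point. If K-Ind Z <= alpha, apply this to the trace U on H(mu) of a
K-neighbourhood taken in Z. An obstruction point x is, for every i, in the
closure of the intersection of the U_j with j <> i [Kobs_closure], hence, X
being a Frechet space, the limit of a sequence in it. These k + 1 sequences
and x form a set S in S_X [SX_of_thin]. Uncountably many m have [phi m = S],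
whereas each of the countably many relations s \in U_j spreads to {m} x {s} x
Y for all but finitely many m; so for some m all of them spread. Then {m} x
{x} x Y, a copy of [Y], is contained in the partition: a point of it in U_i
would have neighbours lying in all the U_j. Its K-Ind would be less than alpha
[fKInd_Z_lower].

K-Ind of a space depends only on the lattice of closed sets. It is therefore
studied relative to a family [F] of sets playing the role of the closed ones
[fKInd_le], with open sets replaced by their complements. Along suitable maps
this notion does not change [fKInd_le_transfer]; this replaces subspaces by
subsets, and replaces Z(X, Y) by a subset of the product A_m x X x Y, with the
closed sets that are saturated for the collapsing relation [KInd_le_ZspaceE].
*)

(** * Preliminaries on sets, ordinals and topologies *)

Lemma set0_of_empty T (A : set T) : (forall x, ~ A x) -> A = set0.
Proof. by move=> A0; apply/seteqP; split=> x // /A0. Qed.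

Lemma finite_set_elim T (Q : set T -> Prop) :
  Q set0 ->
  (forall J x, finite_set J -> ~ J x -> Q J -> Q (x |` J)) ->
  forall J, finite_set J -> Q J.
Proof.
move=> Q0 QU J /finite_setP[n]; elim: n J => [J|n IH J /eq_cardSP[x Jx Jn]].
  by rewrite II0 card_eq0 => /eqP ->.
rewrite -(setD1K Jx); apply: QU; last exact: IH.
- by apply/finite_setP; exists n.
- by case=> _; apply.
Qed.

Lemma closed_preimageT (T U : topologicalType) (f : T -> U) (D : set U) :
  continuous f -> closed D -> closed (f @^-1` D).
Proof. by move=> cf; apply: preimage_closed => x _; exact: cf. Qed.

Lemma closed_point (U : topologicalType) (x : U) :
  hausdorff_space U -> closed [set x].
Proof. by move=> hU; apply: compact_closed => //; exact: compact_set1. Qed.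

Lemma closed_finite (U : topologicalType) (A : set U) :
  hausdorff_space U -> finite_set A -> closed A.
Proof. by move=> hU finA; apply: compact_closed => //; exact: finite_compact. Qed.

Lemma pair_cvg (U V W : topologicalType) (F : set_system U) (f : U -> V)
    (g : U -> W) (v : V) (w : W) : Filter F ->
  f @ F --> v -> g @ F --> w -> (fun u => (f u, g u)) @ F --> ((v, w) : V * W).
Proof. by move=> FF fv gw; exact: cvg_pair. Qed.

Lemma cst_cvg (U V : topologicalType) (F : set_system U) (v : V) :
  Filter F -> (fun _ : U => v) @ F --> v.
Proof. by move=> FF; exact: cvg_cst. Qed.

Lemma olt_le a b : olt a b -> ole a b.
Proof.
elim: (olt_wf a) b => {}a _ IH b ab; have [//|ba] := ole_total a b.
have aa : ole a a by exact: ole_refl.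
by have := IH b ba a ba => /(olt_le_trans ab)/olt_irr.
Qed.

Lemma ole_succ a : ole a (osucc a).
Proof. by apply: olt_le; exists tt; exact: ole_refl. Qed.

(** * The dimension K-Ind relative to a family of closed sets *)

(** With [F] the closed sets of a space, [A] is a closed K-tuple of [P], and the
complements in [P] of the sets [B i] form a K-neighbourhood of [A], whose
K-partition is the intersection of the [B i]. *)
Inductive fKInd_le (k : nat) (T : Type) (F : set (set T)) :
    set T -> Ord -> Prop :=
  fKInd_leI (P : set T) (a : Ord) :
    (forall A : 'I_k.+1 -> set T, (forall i, F (A i)) ->
       (forall i, A i `<=` P) -> \bigcap_i A i = set0 ->
       exists B : 'I_k.+1 -> set T, [/\ forall i, F (B i),
         forall i, A i `&` B i = set0, \bigcup_i B i = P &
         \bigcap_i B i = set0 \/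
         exists2 b, olt b a & fKInd_le k F (\bigcap_i B i) b]) ->
    fKInd_le k F P a.

Definition fKInd_lt k T (F : set (set T)) (P : set T) (a : Ord) : Prop :=
  P = set0 \/ exists2 b, olt b a & fKInd_le k F P b.

(** The condition imposed on a single tuple by [fKInd_le].  It is isolated because
partitions of one tuple over disjoint pieces of [P] are constructed separately and
glued. *)
Definition separated k T (F : set (set T)) (P : set T)
    (A : 'I_k.+1 -> set T) (a : Ord) : Prop :=
  exists B : 'I_k.+1 -> set T, [/\ forall i, F (B i),
    forall i, A i `&` B i = set0, \bigcup_i B i = P &
    fKInd_lt k F (\bigcap_i B i) a].

Section AbstractKInd.
Context (k : nat) (T : Type) (F : set (set T)).
Local Notation tuple := ('I_k.+1 -> set T).
Implicit Types (P Q : set T) (A B : tuple) (a b : Ord).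

Lemma fKInd_leP P a : fKInd_le k F P a <-> forall A, (forall i, F (A i)) ->
  (forall i, A i `<=` P) -> \bigcap_i A i = set0 -> separated F P A a.
Proof. by split=> [[{}P {}a]//|?]; constructor. Qed.

Lemma fKInd_lt_ord P a b : ole a b -> fKInd_lt k F P a -> fKInd_lt k F P b.
Proof.
move=> ab [->|[c ca Pc]]; first by left.
by right; exists c => //; exact: olt_le_trans ab.
Qed.

Lemma separated_ord P A a b : ole a b -> separated F P A a -> separated F P A b.
Proof. by move=> ab [B [? ? ? /(fKInd_lt_ord ab)]]; exists B; split. Qed.

Lemma fKInd_le_ord P a b : ole a b -> fKInd_le k F P a -> fKInd_le k F P b.
Proof.
move=> ab /fKInd_leP H; apply/fKInd_leP => A FA AP A0.
exact: separated_ord ab (H A FA AP A0).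
Qed.

Hypothesis F0 : F set0.

Lemma fKInd_le0 a : fKInd_le k F set0 a.
Proof.
apply/fKInd_leP => A _ A0 _; exists A; split.
- by move=> i; rewrite (set0_of_empty (A0 i)).
- by move=> i; apply: set0_of_empty => x [/A0].
- by apply: set0_of_empty => x [i _ /A0].
- by left; apply: set0_of_empty => x /(_ ord0 I)/A0.
Qed.

Lemma fKInd_le_lt P a b : olt a b -> fKInd_le k F P a -> fKInd_lt k F P b.
Proof. by right; exists a. Qed.

Lemma fKInd_lt_succ P a : fKInd_le k F P a -> fKInd_lt k F P (osucc a).
Proof. by apply: fKInd_le_lt; exists tt; exact: ole_refl. Qed.

Lemma fKInd_ltW P a : fKInd_lt k F P a -> fKInd_le k F P a.
Proof.
case=> [->|[b /olt_le ba]]; first exact: fKInd_le0.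
exact: fKInd_le_ord.
Qed.

Hypothesis FI : forall J (A : J -> set T),
  (forall j, F (A j)) -> F (\bigcap_j A j).

Lemma fam_setI P Q : F P -> F Q -> F (P `&` Q).
Proof.
move=> FP FQ; rewrite (_ : _ `&` _ = \bigcap_b (if b then P else Q)).
  by apply: FI => -[].
apply/seteqP; split=> [x [Px Qx] []|x PQ] //.
by split; [exact: (PQ true)|exact: (PQ false)].
Qed.

(** A partition of a tuple of [Q], regarded as a tuple of [P], is cut down to
[Q]. *)
Lemma fKInd_le_sub P Q a : F Q -> Q `<=` P ->
  fKInd_le k F P a -> fKInd_le k F Q a.
Proof.
elim: (olt_wf a) P Q => {}a _ IH P Q FQ QP /fKInd_leP HP.
apply/fKInd_leP => A FA AQ A0.
have [|B [FB AB BP Blt]] := HP A FA _ A0; first by move=> i x /AQ/QP.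
exists (fun i => B i `&` Q); split=> [i|i||].
- exact: fam_setI.
- by rewrite setIA AB set0I.
- by rewrite -setI_bigcupl BP; exact/setIidr.
- rewrite bigcapIl; last by exists ord0.
  case: Blt => [->|[b ba KB]]; first by left; rewrite set0I.
  right; exists b => //; apply: IH KB => //.
  by apply: fam_setI => //; exact: FI.
Qed.

Lemma fKInd_lt_sub P Q a : F Q -> Q `<=` P ->
  fKInd_lt k F P a -> fKInd_lt k F Q a.
Proof.
move=> FQ QP [P0|[b ba KP]]; first by left; rewrite -subset0 -P0.
by right; exists b => //; exact: fKInd_le_sub KP.
Qed.

Hypothesis FU : forall P Q, F P -> F Q -> F (P `|` Q).

Definition sum_closed a := forall P Q, F P -> F Q -> P `&` Q = set0 ->
  fKInd_le k F P a -> fKInd_le k F Q a -> fKInd_le k F (P `|` Q) a.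

(** Ordinals are totally ordered, so the larger of the two bounds serves both
summands. *)
Lemma fKInd_lt_sum P Q a : (forall b, olt b a -> sum_closed b) ->
  F P -> F Q -> P `&` Q = set0 ->
  fKInd_lt k F P a -> fKInd_lt k F Q a -> fKInd_lt k F (P `|` Q) a.
Proof.
move=> IH FP FQ PQ [->|[b ba KP]]; first by rewrite set0U.
case=> [->|[c ca KQ]]; first by rewrite setU0; right; exists b.
right; have [bc|/olt_le cb] := ole_total b c.
- by exists c => //; apply: IH => //; exact: fKInd_le_ord KP.
- by exists b => //; apply: IH => //; exact: fKInd_le_ord KQ.
Qed.

(** Separate over [P] and over [Q] and take unions: as [P] and [Q] are disjoint, no
new points enter the intersection of the sets [B i `|` C i].  That intersection is
again a disjoint sum, of dimension below [a]; hence the induction hypothesis. *)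
Lemma separated_sum_ind P Q A a : (forall b, olt b a -> sum_closed b) ->
  F P -> F Q -> P `&` Q = set0 -> (forall i, A i `<=` P `|` Q) ->
  separated F P (fun i => A i `&` P) a ->
  separated F Q (fun i => A i `&` Q) a ->
  separated F (P `|` Q) A a.
Proof.
move=> IH FP FQ PQ APQ [B [FB AB BP Blt]] [C [FC AC CQ Clt]].
have BsP i : B i `<=` P by rewrite -BP => x Bx; exists i.
have CsQ i : C i `<=` Q by rewrite -CQ => x Cx; exists i.
have PnQ x : P x -> Q x -> False.
  by move=> Px Qx; have : (P `&` Q) x by []; rewrite PQ.
exists (fun i => B i `|` C i); split=> [i|i||].
- exact: FU.
- apply: set0_of_empty => x [Ax [Bx|Cx]].
  + suff : (A i `&` P `&` B i) x by rewrite AB.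
    by split=> //; split => //; exact: BsP Bx.
  + suff : (A i `&` Q `&` C i) x by rewrite AC.
    by split=> //; split => //; exact: CsQ Cx.
- by rewrite bigcupU BP CQ.
- have -> : \bigcap_i (B i `|` C i) = \bigcap_i B i `|` \bigcap_i C i.
    apply/seteqP; split=> [x BC|x [Bx|Cx] i _]; last 2 first.
    - by left; exact: Bx.
    - by right; exact: Cx.
    have [Bx|Cx] := BC ord0 I.
      left=> i _; have [//|Cx] := BC i I.
      by case: (PnQ x); [exact: BsP Bx|exact: CsQ Cx].
    right=> i _; have [Bx|//] := BC i I.
    by case: (PnQ x); [exact: BsP Bx|exact: CsQ Cx].
  apply: fKInd_lt_sum => //; [exact: FI|exact: FI|].
  by apply: set0_of_empty => x [/(_ ord0 I)/BsP Px /(_ ord0 I)/CsQ]; exact: PnQ.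
Qed.

Lemma separated_of_le P A a : F P -> fKInd_le k F P a -> (forall i, F (A i)) ->
  \bigcap_i A i = set0 -> separated F P (fun i => A i `&` P) a.
Proof.
move=> FP /fKInd_leP HP FA A0; apply: HP => [i|i x []//|]; first exact: fam_setI.
apply: set0_of_empty => x Ax; suff : (\bigcap_i A i) x by rewrite A0.
by move=> i /Ax[].
Qed.

Lemma fKInd_le_sum a : sum_closed a.
Proof.
elim: (olt_wf a) => {}a _ IH P Q FP FQ PQ /fKInd_leP HP /fKInd_leP HQ.
apply/fKInd_leP => A FA APQ A0.
by apply: separated_sum_ind => //; apply: separated_of_le => //; apply/fKInd_leP.
Qed.

Lemma separated_sum P Q A a : F P -> F Q -> P `&` Q = set0 ->
  (forall i, A i `<=` P `|` Q) ->
  separated F P (fun i => A i `&` P) a ->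
  separated F Q (fun i => A i `&` Q) a ->
  separated F (P `|` Q) A a.
Proof. by apply: separated_sum_ind => b _; exact: fKInd_le_sum. Qed.

Lemma fam_bigcup L (J : set L) (P : L -> set T) :
  finite_set J -> (forall m, F (P m)) -> F (\bigcup_(m in J) P m).
Proof.
move=> finJ FP; move: J finJ; apply: finite_set_elim => [|J m _ _ IH].
  by rewrite bigcup_set0.
by rewrite bigcup_setU1; exact: FU.
Qed.

Lemma fKInd_le_bigsum L (J : set L) (P : L -> set T) a :
  finite_set J -> (forall m, F (P m)) -> trivIset setT P ->
  (forall m, fKInd_le k F (P m) a) -> fKInd_le k F (\bigcup_(m in J) P m) a.
Proof.
move=> finJ FP tP KP; move: J finJ; apply: finite_set_elim => [|J m finJ Jm IH].
  by rewrite bigcup_set0; exact: fKInd_le0.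
rewrite bigcup_setU1; apply: fKInd_le_sum => //; first exact: fam_bigcup.
apply: set0_of_empty => x [Pmx [n Jn Pnx]]; apply: Jm.
by rewrite (tP m n I I) //; exists x.
Qed.

End AbstractKInd.

(** * Invariance along maps, and K-Ind of a space *)

(** The hypotheses say that the preimage under [g], cut down to [P], is an
isomorphism from the lattice of the members of [F'] contained in [P'] onto that of
the members of [F] contained in [P].  The relative dimension sees nothing but this
lattice. *)
Section Transfer.
Context (k : nat) (T T' : Type) (F : set (set T)) (F' : set (set T')).
Context (P : set T) (P' : set T') (g : T -> T').
Hypothesis Pg : forall x', P' x' -> exists2 x, P x & g x = x'.
Hypothesis F'F : forall D, F' D -> D `<=` P' -> F (P `&` g @^-1` D).
Hypothesis FF' : forall C, F C -> C `<=` P ->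
  [/\ F' (g @` C), g @` C `<=` P' & P `&` g @^-1` (g @` C) `<=` C].

Lemma lift_bigcap n (D : 'I_n.+1 -> set T') :
  \bigcap_i (P `&` g @^-1` D i) = P `&` g @^-1` \bigcap_i D i.
Proof.
apply/seteqP; split=> [x Dx|x [Px Dx] i _].
  by split; [exact: (Dx ord0 I).1|move=> i _; exact: (Dx i I).2].
by split => //; exact: Dx.
Qed.

Lemma lift_lt (Q : set T') a : Q `<=` P' ->
  (forall b, olt b a ->
     fKInd_le k F (P `&` g @^-1` Q) b <-> fKInd_le k F' Q b) ->
  fKInd_lt k F (P `&` g @^-1` Q) a <-> fKInd_lt k F' Q a.
Proof.
move=> QP' leQ; split=> -[Q0|[b ba Kb]]; try by right; exists b => //; apply/leQ.
  left; apply: set0_of_empty => x' Qx'; have [x Px gx] := Pg (QP' _ Qx').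
  suff : (P `&` g @^-1` Q) x by rewrite Q0.
  by split => //=; rewrite gx.
by left; rewrite Q0 preimage_set0 setI0.
Qed.

Lemma fKInd_le_transfer (Q : set T') a : Q `<=` P' ->
  fKInd_le k F (P `&` g @^-1` Q) a <-> fKInd_le k F' Q a.
Proof.
elim: (olt_wf a) Q => {}a _ IH Q QP'.
have liftlt D : D `<=` P' ->
    fKInd_lt k F (P `&` g @^-1` D) a <-> fKInd_lt k F' D a.
  by move=> DP'; apply: lift_lt => // b ba; exact: IH.
have imgK C : F C -> C `<=` P -> P `&` g @^-1` (g @` C) = C.
  move=> FC CP; have [_ _ gC] := FF' FC CP; apply/seteqP; split => // x Cx.
  by split; [exact: CP|exists x].
split=> /fKInd_leP H; apply/fKInd_leP => A FA AQ A0.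
- have [i|i x [Px /AQ//]||B [FB AB BQ Blt]] :=
    H (fun i => P `&` g @^-1` A i).
  + by apply: F'F => // x /AQ/QP'.
  + by rewrite lift_bigcap A0 preimage_set0 setI0.
  have BP i : B i `<=` P.
    by move=> x Bx; have : (\bigcup_i B i) x by [exists i]; rewrite BQ => -[].
  have Q'P' : \bigcup_i (g @` B i) `<=` Q.
    move=> _ [i _ [x Bx <-]].
    by have : (\bigcup_i B i) x by [exists i]; rewrite BQ => -[].
  exists (fun i => g @` B i); split=> [i|i||].
  + by have [] := FF' (FB i) (BP i).
  + apply: set0_of_empty => _ [] /[swap] -[x Bx <-] Ax.
    suff : (P `&` g @^-1` A i `&` B i) x by rewrite AB.
    by split => //; split => //; exact: BP Bx.
  + apply/seteqP; split => // x' Qx'; have [x Px gx] := Pg (QP' _ Qx').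
    have : (P `&` g @^-1` Q) x by split => //=; rewrite gx.
    by rewrite -BQ => -[i _ Bx]; exists i => //; exists x.
  + apply/liftlt; first by move=> x' /(_ ord0 I) Bx; apply/QP'/Q'P'; exists ord0.
    rewrite -lift_bigcap; congr (fKInd_lt _ _ _ _): Blt.
    by apply: eq_bigcapr => i _; rewrite imgK.
- have AP i : A i `<=` P by move=> x /AQ[].
  have [i|i _ [x /AQ[_ ?] <-]//||B [FB AB BQ Blt]] := H (fun i => g @` A i).
  + by have [] := FF' (FA i) (AP i).
  + apply: set0_of_empty => x' Ax'; have [x Ax xE] := Ax' ord0 I.
    suff : (\bigcap_i A i) x by rewrite A0.
    move=> i _; rewrite -(imgK _ (FA i) (AP i)); split; first exact: AP Ax.
    by rewrite /= xE; exact: Ax'.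
  have BP' i : B i `<=` P'.
    by move=> x Bx; apply: QP'; rewrite -BQ; exists i.
  exists (fun i => P `&` g @^-1` B i); split=> [i|i||].
  + exact: F'F.
  + apply: set0_of_empty => x [Ax [Px Bx]].
    suff : (g @` A i `&` B i) (g x) by rewrite AB.
    by split => //; exists x.
  + by rewrite -setI_bigcupr -preimage_bigcup BQ.
  + rewrite lift_bigcap; apply/liftlt => // x /(_ ord0 I); exact: BP'.
Qed.

Lemma fKInd_lt_transfer (Q : set T') a : Q `<=` P' ->
  fKInd_lt k F (P `&` g @^-1` Q) a <-> fKInd_lt k F' Q a.
Proof. by move=> QP'; apply: lift_lt => // b _; exact: fKInd_le_transfer. Qed.

End Transfer.

(** The closed sets of a closed subspace are the closed sets contained in it. *)
Lemma fKInd_le_set_type k (X : topologicalType) (P Q : set X) a :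
  closed P -> Q `<=` P ->
  fKInd_le k (@closed (set_type P)) (val @^-1` Q) a <->
  fKInd_le k (@closed X) Q a.
Proof.
move=> clP QP; rewrite -(setTI (val @^-1` Q)).
apply: (@fKInd_le_transfer k _ _ _ _ setT P val) => [x Px|D clD DP|C clC _|//].
- by exists (SigSub (mem_set Px)).
- by rewrite setTI; apply: closed_preimageT clD; exact: initial_continuous.
have [W oW WE] : exists2 W, open W & val @^-1` W = ~` C.
  by move: clC; rewrite -openC => -[W oW <-]; exists W.
have imC : val @` C = P `&` ~` W.
  apply/seteqP; split=> [_ [x Cx <-]|x [Px Wx]].
    split; first exact: (set_mem (valP x)).
    move=> Wx; have : (val @^-1` W) x by [].
    by rewrite WE.
  exists (SigSub (mem_set Px)) => //; apply: contrapT => nC.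
  by have : (~` C) (SigSub (mem_set Px)) by []; rewrite -WE.
split; first by rewrite imC; apply: closedI => //; exact: open_closedC.
- by rewrite imC => x [].
- by move=> x [_ /= [y Cy /val_inj <-]].
Qed.

Lemma KInd_le_inv k (X : topologicalType) a : KInd_le k X a ->
  forall A : 'I_k.+1 -> set X, closed_Ktuple A ->
  exists2 P : set X, Kpartition A P &
    P = set0 \/ exists2 b, olt b a & KInd_le k (set_type P) b.
Proof. by case. Qed.

(** Complementation exchanges K-neighbourhoods with the separating tuples of closed
sets; the subspaces that occur in the inductive definition become subsets by
[fKInd_le_set_type]. *)
Lemma KInd_leE k (X : topologicalType) a :
  KInd_le k X a <-> fKInd_le k (@closed X) setT a.
Proof.
elim: (olt_wf a) X => {}a _ IH X.
have lt_iff (P : set X) : closed P ->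
    (P = set0 \/ exists2 b, olt b a & KInd_le k (set_type P) b) <->
    fKInd_lt k (@closed X) P a.
  have PT : val @^-1` P = [set: set_type P].
    by apply/seteqP; split=> // x _; exact: (set_mem (valP x)).
  move=> clP; split=> -[->|[b ba Kb]]; try by left.
    right; exists b => //; apply/(fKInd_le_set_type _ _ clP) => //.
    by rewrite PT; apply/IH.
  by right; exists b => //; apply/IH => //; rewrite -PT; apply/fKInd_le_set_type.
have CI (A : 'I_k.+1 -> set X) :
    \bigcap_i ~` A i = ~` \bigcup_i A i by rewrite setC_bigcup.
split.
- move=> /KInd_le_inv H; apply/fKInd_leP => A clA _ A0.
  have [_ [U [[U0 oU] AU] ->] Plt] := H A (conj A0 clA).
  exists (fun i => ~` U i); split=> [i|i||].
  + exact: open_closedC.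
  + by apply: set0_of_empty => x [/AU].
  + by rewrite -setC_bigcap [X in ~` X]U0 setC0.
  + rewrite CI; apply/lt_iff => //; apply: open_closedC.
    exact: bigcup_open.
- move=> /fKInd_leP H; constructor=> A [A0 clA].
  have [//|B [clB AB BT Blt]] := H A clA _ A0.
  exists (\bigcap_i B i).
    exists (fun i => ~` B i).
      split; [split|].
      * by rewrite /Ktuple -setC_bigcup BT setCT.
      * by move=> i; exact: closed_openC.
      * by move=> i x Ax Bx; suff : (A i `&` B i) x by rewrite AB.
    by rewrite setC_bigcup; apply: eq_bigcapr => i _; rewrite setCK.
  by apply/lt_iff => //; exact: closed_bigI.
Qed.

Lemma KInd_le_closedE k (X : topologicalType) (P : set X) a : closed P ->
  KInd_le k (set_type P) a <-> fKInd_le k (@closed X) P a.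
Proof.
move=> clP; rewrite KInd_leE -(fKInd_le_set_type k a clP (@subset_refl _ P)).
suff -> : val @^-1` P = [set: set_type P] by [].
by apply/seteqP; split=> // x _; exact: (set_mem (valP x)).
Qed.

(** * Finite sets and convergent sequences *)

Section Acpt.
Variable M : choiceType.

(** On an infinite [K] the complements of finite sets form a proper filter without
cluster point. *)
Lemma discrete_compact_finite (K : set (discrete_topology M)) :
  compact K -> finite_set K.
Proof.
move=> cK; apply: contrapT => infK.
pose G : set_system (discrete_topology M) := [set U | finite_set (K `\` U)].
have PG : ProperFilter G.
  split; first by rewrite /G /= setD0.
  split; first by rewrite /G /= setDT.
  - by move=> U V GU GV; rewrite /G /= setDIr finite_setU.
  - by move=> U V UV; apply: sub_finite_set => m [Km nV]; split => // /UV.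
have [|m [Km /(_ (K `\ m) [set m])]] := cK G PG; first by rewrite /G /= setDv.
case=> [||n [[_ nm] //]].
- rewrite /G /=; apply: sub_finite_set (finite_set1 m) => n [Kn nKm].
  by apply: contrapT => nm; apply: nKm.
- exact: discrete_set1.
Qed.

Lemma nbhs_Acpt_None (W : set (Acpt M)) :
  nbhs (None : Acpt M) W <-> W None /\ finite_set [set m | ~ W (Some m)].
Proof.
split=> [[K [cK _] KW]|[W0 finW]].
  split; first by apply: KW; right.
  apply: sub_finite_set (discrete_compact_finite cK) => m /= Wm.
  by apply: contrapT => Km; apply: Wm; apply: KW; left; exists m.
exists [set m | ~ W (Some m)].
  by split; [exact: (@finite_compact (discrete_topology M))|exact: discrete_closed].
by move=> [m|//] [] // [n /= /contrapT Wn [<-]].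
Qed.

Lemma nbhs_Acpt_Some m (W : set (Acpt M)) :
  nbhs (Some m : Acpt M) W <-> W (Some m).
Proof.
split=> [/nbhs_singleton//|Wm].
change (nbhs (m : discrete_topology M) (Some @^-1` W)).
by apply: filterS (discrete_set1 _) => _ ->.
Qed.

Lemma Acpt_hausdorff : hausdorff_space (Acpt M).
Proof.
apply: one_point_compactification_hausdorff; last exact: discrete_hausdorff.
move=> m _; exists [set m]; last by split; [exact: compact_set1|exact: discrete_closed].
by rewrite withinET; exact: discrete_set1.
Qed.

Lemma closed_Acpt_None (W : set (Acpt M)) : W None -> closed W.
Proof.
move=> W0; rewrite -openC openE => -[m|//] Wm.
exact/nbhs_Acpt_Some.
Qed.

End Acpt.

(** Covers both kinds of members of S_X at once: every point of [S] other than
[x] is isolated in [S], and if [S] is infinite, then it converges to [x]. *)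
Definition thin (X : topologicalType) (S : set X) (x : X) :=
  forall W : set X, open W -> W x -> finite_set (S `\` W).

(** A point of [E] in [S] is isolated in [S]: it and [x] have disjoint
neighbourhoods, and the one of [x] contains all but finitely many points of [S]. *)
Lemma thin_closedD (X : topologicalType) (S E : set X) x :
  hausdorff_space X -> closed S -> thin S x -> ~ E x -> closed (S `\` E).
Proof.
move=> hX clS tS nEx z clz; have Sz : S z.
  by apply: clS => U /clz[w [[Sw _] Uw]]; exists w.
split=> // Ez; have zx : z != x by apply/eqP => zx; apply: nEx; rewrite -zx.
move: (hX); rewrite open_hausdorff => /(_ z x zx)[[A B] [/= + +] [oA oB AB]].
rewrite !inE => Az Bx.
have oN : open (~` ((S `\` B) `\ z)).
  apply: closed_openC; apply: closed_finite => //.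
  by apply: sub_finite_set (tS B oB Bx) => w [].
have [|w [[Sw nEw] [Aw Nw]]] := clz (A `&` ~` ((S `\` B) `\ z)).
  by apply: open_nbhs_nbhs; split; [exact: openI|split => // -[_]; apply].
apply: Nw; split; last by move=> wz; apply: nEw; rewrite wz.
split => // Bw; suff : (A `&` B) w by rewrite (eqP AB).
by [].
Qed.

(** In a copy of the compactification of nat the point [x] is the image of infinity;
for a finite [S] any point of the space serves. *)
Lemma SX_thin (X : topologicalType) (S : set X) :
  hausdorff_space X -> [set: X] !=set0 -> SX X S ->
  closed S /\ exists x, thin S x.
Proof.
move=> hX [x0 _] [finS|[f [g [cf cg fK gK]]]].
  split; first exact: closed_finite.
  by exists x0 => W _ _; apply: sub_finite_set finS => x [].
pose h : Acpt nat -> X := fun n => val (g n).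
have ch : continuous h.
  move=> n; apply: (cvg_comp g val (cg n)).
  exact: (@initial_continuous (set_type S) X val).
have Sh : S = h @` setT.
  apply/seteqP; split=> [x Sx|_ [n _ <-]]; last exact: (set_mem (valP (g n))).
  by exists (f (SigSub (mem_set Sx))) => //; rewrite /h fK.
split.
  rewrite Sh; apply: compact_closed => //; apply: continuous_compact.
    exact: continuous_subspaceT.
  exact: one_point_compactification_compact.
exists (h None) => W oW Wx.
have : nbhs (None : Acpt nat) (h @^-1` W).
  by exact: (ch None W (open_nbhs_nbhs (conj oW Wx))).
case/nbhs_Acpt_None => _ /(finite_image (h \o Some)); apply: sub_finite_set.
by rewrite Sh => x [[[n|] _ <-] nW] //; exists n.
Qed.

(** Enumerate [R] without repetition; sending the n-th isolated point of the
compactification of nat to the n-th point of [R] and infinity to [x] is a continuous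
bijection from a compact space to a Hausdorff one. *)
Lemma SX_of_thin (X : topologicalType) (R : set X) x : hausdorff_space X ->
  thin R x -> countable R -> ~ finite_set R -> ~ R x -> SX X (x |` R).
Proof.
move=> hX tR cR infR nRx; right.
have /card_set_bijP[f [_ finj fsurj]] : (R #= [set: nat])%card.
  rewrite card_eq_le; apply/andP; split; first exact: cR.
  apply: contrapT => H; exact/infR/finite_setPn.
have /choice[e eP] n : exists y, R y /\ f y = n.
  by have [y Ry fy] := fsurj n I; exists y.
have Se (a : Acpt nat) : (x |` R) (if a is Some n then e n else x).
  by case: a => [n|]; [right; exact: (eP n).1|left].
pose g (a : Acpt nat) : set_type (x |` R) := SigSub (mem_set (Se a)).
pose h (s : set_type (x |` R)) : Acpt nat :=
  if pselect (val s = x) then None else Some (f (val s)).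
have hg : cancel g h.
  move=> [n|]; rewrite /h; case: pselect => //=; last by rewrite (eP n).2.
  by move=> en; case: nRx; rewrite -en; exact: (eP n).1.
have gh : cancel h g.
  move=> s; apply: val_inj; rewrite /h; case: pselect => [sx|sx] /=; first by rewrite sx.
  have [//|Rs] : (x |` R) (val s) by exact: (set_mem (valP s)).
  by apply: finj; rewrite ?inE //; [exact: (eP _).1|exact: (eP _).2].
have vgP : continuous (fun a => val (g a)).
  move=> [n|] /= W.
    by move=> /nbhs_singleton Wn; exact/nbhs_Acpt_Some.
  rewrite nbhsE => -[O [oO Ox] OW]; apply/nbhs_Acpt_None; split; first exact: OW.
  apply: sub_finite_set (finite_image f (tR O oO Ox)) => n /= nWn.
  exists (e n); last exact: (eP n).2.
  by split; [exact: (eP n).1|move=> /OW].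
have cg : continuous g.
  apply/continuousP => _ [O oO <-].
  by move/continuousP : vgP => /(_ O oO).
exists h, g; split => //.
apply/continuous_closedP => D clD.
rewrite (_ : h @^-1` D = val @^-1` ((fun a => val (g a)) @` D)).
  apply: closed_preimageT.
    exact: (@initial_continuous (set_type (x |` R)) X val).
  apply: compact_closed => //; apply: continuous_compact.
    exact: continuous_subspaceT.
  have cA := @one_point_compactification_compact (discrete_topology nat).
  exact: (subclosed_compact clD cA).
apply/seteqP; split=> [s Ds|s [a Da /val_inj <-]]; last by rewrite /preimage /= hg.
by exists (h s) => //; rewrite gh.
Qed.

(** A set of cardinality above the weight of [X] could be countable only if [X] had a
finite base [B].  But each [r] in [R] is missed by some [b] in [B] containing [x],
and every such [b] misses only finitely many points of [R]. *)
Lemma thin_uncountable (X : topologicalType) (M : choiceType) (R : set X) x :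
  hausdorff_space X -> thin R x -> ~ finite_set R -> ~ R x -> weight_lt X M ->
  ~ countable [set: M].
Proof.
move=> hX tR infR nRx [B [oB Bx] MB] cM.
have finB : finite_set B.
  by apply/finite_setPn => natB; apply: MB; exact: card_le_trans cM natB.
apply: infR.
apply: (@sub_finite_set _ _ (\bigcup_(b in B `&` [set b | b x]) (R `\` b))).
  move=> r Rr; have rx : nbhs x (~` [set r]).
    apply: open_nbhs_nbhs; split; first by apply: closed_openC; exact: closed_point.
    by move=> xr; apply: nRx; rewrite xr.
  have [b [Bb bx] br] := Bx x _ rx.
  by exists b => //; split => // /br; apply.
apply: bigcup_finite; first by apply: sub_finite_set finB => b [].
by move=> b [Bb bx]; apply: tR => //; exact: oB.
Qed.

(** * Closed saturated subsets of A_m x X x Y *)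

Section ProductZ.
Context (X Y : topologicalType) (M : choiceType).
Hypothesis cX : compact [set: X].
Hypothesis hX : hausdorff_space X.
Hypothesis cY : compact [set: Y].
Hypothesis hY : hausdorff_space Y.
Local Notation ZP := (Zprod X Y M).
Implicit Types (C : set X) (T : M -> set X).

Definition prA (p : ZP) : Acpt M := p.1.1.
Definition prX (p : ZP) : X := p.1.2.
Definition prY (p : ZP) : Y := p.2.

Lemma prA_continuous : continuous prA.
Proof. by move=> p; apply: (cvg_comp fst fst); exact: cvg_fst. Qed.

Lemma prX_continuous : continuous prX.
Proof. by move=> p; apply: (cvg_comp fst snd); [exact: cvg_fst|exact: cvg_snd]. Qed.

Lemma prY_continuous : continuous prY.
Proof. by move=> p; exact: cvg_snd. Qed.

Lemma Zprod_compact : compact [set: ZP].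
Proof.
rewrite -setXTT; apply: compact_setX => //; rewrite -setXTT; apply: compact_setX => //.
exact: one_point_compactification_compact.
Qed.

Lemma closed_image_Zprod (U : topologicalType) (f : ZP -> U) (A : set ZP) :
  hausdorff_space U -> continuous f -> closed A -> closed (f @` A).
Proof.
move=> hU cf clA; apply: compact_closed => //; apply: continuous_compact.
  exact: continuous_subspaceT.
exact: subclosed_compact clA Zprod_compact _.
Qed.

(** The projection of [A] to the first factor is compact and misses the point at
infinity. *)
Lemma finite_slices (A : set ZP) :
  closed A -> (forall p, A p -> prA p <> None) ->
  finite_set [set m | exists2 p, A p & prA p = Some m].
Proof.
move=> clA A0; have clp := closed_image_Zprod (@Acpt_hausdorff M) prA_continuous clA.
have : nbhs (None : Acpt M) (~` (prA @` A)).
  apply: open_nbhs_nbhs; split; first exact: closed_openC.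
  by move=> [p Ap /(A0 _ Ap)].
case/nbhs_Acpt_None => _; apply: sub_finite_set => m [p Ap pm] /=.
by apply; exists p.
Qed.

Lemma slice_cvg (F : set_system X) a (x : X) y : Filter F -> F --> x ->
  (fun z => (a, z, y) : ZP) @ F --> ((a, x, y) : ZP).
Proof.
move=> FF Fx; apply: (@pair_cvg X (Acpt M * X)%type Y); last exact: cst_cvg.
by apply: (@pair_cvg X (Acpt M) X) => //; exact: cst_cvg.
Qed.

Lemma closed_at_Y (A : set ZP) (a : Acpt M) x : closed A ->
  closed [set y | A (a, x, y)].
Proof.
move=> clA; apply: (closed_preimageT (f := fun y => (a, x, y) : ZP)) => // y.
by apply: (@pair_cvg Y (Acpt M * X)%type Y); [exact: cst_cvg|exact: cvg_id].
Qed.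

Lemma closed_at_X (A : set ZP) (a : Acpt M) y : closed A ->
  closed [set x | A (a, x, y)].
Proof.
move=> clA; apply: (closed_preimageT (f := fun x => (a, x, y) : ZP)) => // x.
by apply: slice_cvg; exact: cvg_id.
Qed.

(** The preimages of the closed sets of the quotient [ZN]. *)
Definition Zsat : set (set ZP) := [set A | closed A /\
  forall p q, A p -> prA p = None -> prA q = None -> prX p = prX q -> A q].

Lemma Zsat0 : Zsat set0. Proof. by split => //; exact: closed0. Qed.

Lemma ZsatI J (A : J -> set ZP) : (forall j, Zsat (A j)) -> Zsat (\bigcap_j A j).
Proof.
move=> AZ; split; first by apply: closed_bigI => j _; exact: (AZ j).1.
by move=> p q Ap p0 q0 pq j _; exact: (AZ j).2 p q (Ap j I) p0 q0 pq.
Qed.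

Lemma ZsatU A B : Zsat A -> Zsat B -> Zsat (A `|` B).
Proof.
move=> [cA sA] [cB sB]; split; first exact: closedU.
by move=> p q [Ap|Bp] p0 q0 pq; [left; exact: sA Ap _ _ _|right; exact: sB Bp _ _ _].
Qed.

Lemma Zsat_lattice : [/\ Zsat set0,
  forall J (A : J -> set ZP), (forall j, Zsat (A j)) -> Zsat (\bigcap_j A j) &
  forall A B, Zsat A -> Zsat B -> Zsat (A `|` B)].
Proof. by split; [exact: Zsat0|exact: ZsatI|exact: ZsatU]. Qed.

Definition box (m : M) (S : set X) (D : set Y) : set ZP :=
  [set p | [/\ prA p = Some m, S (prX p) & D (prY p)]].

(** Fiber [C] over infinity and [T m] over [m], times [Y]; with [C] everything and
[T] equal to [phi] this is the preimage of Z(X, Y). *)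
Definition bundle C T : set ZP :=
  [set p | if prA p is Some m then T m (prX p) else C (prX p)].

Lemma Zsat_box m S D : closed S -> closed D -> Zsat (box m S D).
Proof.
move=> cS cD; split; last by move=> p q [-> _ _].
have -> : box m S D = prA @^-1` [set Some m] `&` prX @^-1` S `&` prY @^-1` D.
  by apply/seteqP; split=> p [] // [].
apply: closedI; last exact: closed_preimageT prY_continuous _.
apply: closedI; last exact: closed_preimageT prX_continuous _.
apply: closed_preimageT prA_continuous _.
apply: compact_closed; first exact: Acpt_hausdorff.
exact: compact_set1.
Qed.

(** Relative to the product with [C], which is closed, a bundle is cut out by one
condition for each [m], and this condition only concerns the clopen slice over
[m]. *)
Lemma Zsat_bundle C T : closed C -> (forall m, closed (T m)) ->
  (forall m, T m `<=` C) -> Zsat (bundle C T).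
Proof.
move=> cC cT TC; split; last first.
  by move=> p q; rewrite /bundle /= => + p0 q0 <-; rewrite p0 q0.
have -> : bundle C T = prX @^-1` C `&`
    \bigcap_m (prA @^-1` (~` [set Some m]) `|` prX @^-1` T m).
  apply/seteqP; split=> p; rewrite /bundle /=.
    case E: (prA p) => [m|] Tp; last by split=> // n _; left => /=; rewrite E.
    split=> [|n _ /=]; first exact: TC Tp.
    by rewrite E; have [->|nm] := pselect (n = m); [right|left => -[] /esym].
  by case E: (prA p) => [m|] [Cp Tp] //; have [] := Tp m I => //=; rewrite E.
apply: closedI; first exact: closed_preimageT prX_continuous _.
apply: closed_bigI => m _; apply: closedU; last exact: closed_preimageT prX_continuous _.
by apply: closed_preimageT prA_continuous _; exact: closed_Acpt_None.
Qed.

End ProductZ.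

(** * K-Ind of Z and of its slices *)

Section ZTransfers.
Context (k : nat) (X Y : topologicalType) (M : choiceType).
Hypothesis cX : compact [set: X].
Hypothesis hX : hausdorff_space X.
Hypothesis cY : compact [set: Y].
Hypothesis hY : hausdorff_space Y.
Local Notation ZP := (Zprod X Y M).
Local Notation Zs := (@Zsat X Y M).

(** Collapsing turns the slice over infinity into [X]: a saturated subset of it is
determined by its projection. *)
Lemma bundle0_lifting (y0 : Y) :
  [/\ forall x' : X, setT x' -> exists2 p : ZP, prA p = None & prX p = x',
      forall D : set X, closed D -> D `<=` setT ->
        Zs ([set p | prA p = None] `&` @prX X Y M @^-1` D) &
      forall C, Zs C -> C `<=` [set p | prA p = None] ->
        [/\ closed (@prX X Y M @` C), @prX X Y M @` C `<=` setT &
        [set p | prA p = None] `&` @prX X Y M @^-1` (@prX X Y M @` C) `<=` C]].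
Proof.
split=> [x _|D clD _|C [clC sC] C0].
- by exists (None, x, y0).
- rewrite (_ : _ `&` _ = bundle D (fun=> set0)).
    by apply: Zsat_bundle => // m; [exact: closed0|exact: sub0set].
  by apply/seteqP; split=> p; rewrite /bundle /=; case: (prA p) => [m|] // [].
- split=> //; first by apply: closed_image_Zprod clC => //; exact: prX_continuous.
  by move=> p [p0 [q Cq qp]]; apply: (sC q p) => //; exact: C0.
Qed.

Lemma bundle0E (Q : set X) :
  bundle Q (fun=> set0) = [set p : ZP | prA p = None] `&` @prX X Y M @^-1` Q.
Proof.
by apply/seteqP; split=> p; rewrite /bundle /=; case: (prA p) => [m|] // [].
Qed.

Lemma fKInd_lt_bundle0 (Q : set X) a : [set: Y] !=set0 ->
  fKInd_lt k Zs (bundle Q (fun=> set0)) a <-> fKInd_lt k (@closed X) Q a.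
Proof.
case=> y0 _; rewrite bundle0E; have [h1 h2 h3] := bundle0_lifting y0.
exact: fKInd_lt_transfer h1 h2 h3 _ _ _.
Qed.

Lemma fKInd_le_box1 m (x : X) (D : set Y) a :
  fKInd_le k Zs (box m [set x] D) a <-> fKInd_le k (@closed Y) D a.
Proof.
have boxE B : box m [set x] B = box m [set x] setT `&` @prY X Y M @^-1` B.
  by apply/seteqP; split=> p [] // [].
rewrite boxE; apply: fKInd_le_transfer (@subsetT _ _) => [y _|B clB _|C [clC _] CP].
- by exists (Some m, x, y).
- by rewrite -boxE; apply: Zsat_box => //; exact: closed_point.
- split=> //; first by apply: closed_image_Zprod clC => //; exact: prY_continuous.
  move=> [[pA pX] pY] [[/= pm px _] [[[qA qX] qY] Cq /= qp]].
  have [/= qm qx _] := CP _ Cq; move: Cq; rewrite /prA/prX/prY /= in pm px qp qm qx *.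
  by rewrite pm px qm qx qp.
Qed.

(** Z(X, Y) is closed in the quotient, so its closed sets correspond to the closed
saturated sets contained in its preimage. *)
Lemma KInd_le_ZspaceE (phi : M -> set X) a : (forall m, closed (phi m)) ->
  KInd_le k (Zspace Y phi) a <-> fKInd_le k Zs (bundle setT phi) a.
Proof.
move=> clphi.
have ZpiE (p q : ZP) : Zpi p = Zpi q <->
    p = q \/ [/\ prA p = None, prA q = None & prX p = prX q].
  split=> [/eqmodP/asboolP//|pq]; apply/eqmodP; exact/asboolP.
have ZpiZ (p : ZP) :
    (\bigcup_a @Zslice X Y M phi a) (Zpi p) <-> bundle setT phi p.
  split.
    case=> -[m|] _ [q /= qE /ZpiE[<-|[q0 p0 pq]]]; rewrite /bundle /=.
    - by case: qE; rewrite /prA => ->.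
    - by rewrite p0.
    - by rewrite /prA qE.
    - by rewrite p0.
  rewrite /bundle /=; case E: (prA p) => [m|] Hp.
    by exists (Some m) => //; exists p.
  by exists None => //; exists p.
have clE (D : set (ZN X Y M)) : closed D <-> closed (@Zpi X Y M @^-1` D).
  by rewrite -!openC.
have satE (C : set ZP) : Zs C -> @Zpi X Y M @^-1` (@Zpi X Y M @` C) = C.
  move=> [_ sC]; apply/seteqP; split=> [p [q Cq /ZpiE[<-//|[q0 p0 qp]]]|p Cp].
    exact: (sC q).
  by exists p.
have ZsG : Zs (bundle setT phi) by apply: Zsat_bundle => //; exact: closedT.
have clZ : closed (\bigcup_a @Zslice X Y M phi a).
  apply/clE; rewrite (_ : _ @^-1` _ = bundle setT phi); first exact: ZsG.1.
  by apply/seteqP; split=> p /ZpiZ.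
rewrite /Zspace KInd_le_closedE //.
rewrite -(_ : bundle setT phi `&` @Zpi X Y M @^-1`
    (\bigcup_a @Zslice X Y M phi a) = bundle setT phi).
  symmetry; apply: fKInd_le_transfer (@subset_refl _ _)
    => [z [[m|] _ [p pE <-]]|D clD _|C ZC CZ].
  - by exists p => //; apply/ZpiZ; exists (Some m) => //; exists p.
  - by exists p => //; apply/ZpiZ; exists None => //; exists p.
  - split; first by apply: closedI; [exact: ZsG.1|exact/clE].
    move=> p q [Gp Dp] p0 q0 pq; split; first exact: ZsG.2 Gp _ _ _.
    by rewrite /preimage /= -(_ : Zpi p = Zpi q) //; apply/ZpiE; right.
  - rewrite satE //; split; last by move=> p [].
      by apply/clE; rewrite satE //; exact: ZC.1.
    by move=> _ [p /CZ Gp <-]; exact/ZpiZ.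
by apply/seteqP; split=> [p []//|p Gp]; split => //; exact/ZpiZ.
Qed.

End ZTransfers.

(** * The upper bound *)

Section UpperBound.
Context (k : nat) (X Y : topologicalType) (M : choiceType).
Hypothesis k1 : (1 <= k)%N.
Hypothesis X0 : [set: X] !=set0.
Hypothesis cX : compact [set: X].
Hypothesis hX : hausdorff_space X.
Hypothesis Y0 : [set: Y] !=set0.
Hypothesis cY : compact [set: Y].
Hypothesis hY : hausdorff_space Y.
Local Notation ZP := (Zprod X Y M).
Local Notation Zs := (@Zsat X Y M).

(** Let [B] separate the restriction of the tuple to the fiber over [x].  By
compactness of [D] the same [B] works over all points of [S] but finitely many,
which lie in the closed set [bad].  The remaining part of [S] is again thin, and the
partition there is its product with the intersection of the [B i], to which
induction applies; the finitely many other fibers are clopen copies of [D]. *)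
Lemma fKInd_le_box m (S : set X) x (D : set Y) a : closed S -> thin S x ->
  closed D -> fKInd_le k (@closed Y) D a -> fKInd_le k Zs (box m S D) a.
Proof.
elim: (olt_wf a) S D => {}a _ IH S D clS tS clD KD.
apply/fKInd_leP => A ZA AP A0.
have AxD i : [set y | A i (Some m, x, y)] `<=` D by move=> y /AP[].
have [B [clB AB BD Blt]] :
    separated (@closed Y) D (fun i => [set y | A i (Some m, x, y)]) a.
  move/fKInd_leP: KD; apply => //.
    by move=> i; apply: closed_at_Y; exact: (ZA i).1.
  apply: set0_of_empty => y Ay; suff : (\bigcap_i A i) (Some m, x, y) by rewrite A0.
  by move=> i _; exact: Ay.
(* Points over which some [A i] meets [B i]. *)
pose bad := \bigcup_i @prX X Y M @` (A i `&` @prY X Y M @^-1` B i).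
have clbad : closed bad.
  apply: closed_bigcup => [|i _]; first exact: finite_finset.
  apply: closed_image_Zprod => //; first exact: prX_continuous.
  apply: closedI; first exact: (ZA i).1.
  exact: closed_preimageT (@prY_continuous X Y M) (clB i).
have nbx : ~ bad x.
  move=> [i _ [[[pA pX] y] [Ap Bp] /= px]].
  have [/= pm _ _] := AP _ _ Ap; move: Ap Bp; rewrite /prA/prX/prY/= in pm px *.
  rewrite pm px => Ap Bp; suff : ([set y | A i (Some m, x, y)] `&` B i) y by rewrite AB.
  by [].
have finS : finite_set (S `&` bad).
  apply: sub_finite_set (tS (~` bad) (closed_openC clbad) nbx) => s [Ss bs].
  by split => // /(_ bs).
have clS' : closed (S `\` (S `&` bad)) by apply: (thin_closedD hX clS tS) => -[].
have tS' : thin (S `\` (S `&` bad)) x.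
  by move=> W oW Wx; apply: sub_finite_set (tS W oW Wx) => s [[Ss _] Ws].
have BsD i : B i `<=` D by rewrite -BD => y By; exists i.
have [F0 FI FU] := @Zsat_lattice X Y M.
have boxE : box m S D = box m (S `\` (S `&` bad)) D `|`
    \bigcup_(s in S `&` bad) box m [set s] D.
  apply/seteqP; split=> [p [pm Sp Dp]|p [[pm [Sp _] Dp]|[s [Ss _] [pm ps Dp]]]].
  - have [bp|nbp] := pselect (bad (prX p)); first by right; exists (prX p).
    by left; split => //; split => // -[_ /nbp].
  - by [].
  - by split => //; rewrite ps.
have Zs1 s : Zs (box m [set s] D) by apply: Zsat_box => //; exact: closed_point.
rewrite boxE; apply: separated_sum => //.
- exact: Zsat_box.
- exact: fam_bigcup.
- apply: set0_of_empty => p [[_ [_ nS] _] [s Ss [_ ps _]]].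
  by apply: nS; rewrite ps.
- by rewrite -boxE.
- exists (fun i => box m (S `\` (S `&` bad)) (B i)); split=> [i|i||].
  + exact: Zsat_box.
  + apply: set0_of_empty => p [[Ap [_ [Sp nS] _]] [_ _ Bp]]; apply: nS; split => //.
    by exists i => //; exists p.
  + apply/seteqP; split=> [p [i _ [pm Sp /BsD Dp]]//|p [pm Sp]].
    by rewrite -BD => -[i _ Bp]; exists i.
  + rewrite (_ : \bigcap_i _ = box m (S `\` (S `&` bad)) (\bigcap_i B i)); last first.
      apply/seteqP; split=> [p Bp|p [pm Sp Bp] i _]; last by split => //; exact: Bp.
      have [pm Sp _] := Bp ord0 I; split => // i _.
      by have [] := Bp i I.
    case: Blt => [->|[b ba KB]].
      by left; apply: set0_of_empty => p [].
    by right; exists b => //; apply: IH => //; exact: closed_bigI.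
- apply: separated_of_le => //; first exact: fam_bigcup.
  apply: fKInd_le_bigsum => //; last by move=> s; apply/fKInd_le_box1.
  by move=> s t _ _ [p [[_ /= <- _] [_ /= <- _]]].
Qed.

(** The points of [E m] are isolated in [T m], and can therefore be removed from the
partition.  Let [B] separate the restriction of the tuple to the slice over
infinity, and let [Q] be the intersection of the [B i].  The same [B] works over all
[m] outside a finite set [F], and over [F] the bound on the slices is used.
Elsewhere the points of [E m] lying in [Q] are taken out of [B ord0]; as [k >= 1]
they remain in another [B i].  This leaves as partition the bundle over [Q] with
fibers contained in [(T m `&` Q) `\` E m]. *)
Lemma fKInd_le_bundle (C : set X) (T E : M -> set X) c a :
  closed C -> (forall m, closed (T m)) -> (forall m, T m `<=` C) ->
  (forall m E', E' `<=` E m -> closed (T m `\` E')) ->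
  fKInd_le k (@closed X) C c ->
  (forall m, fKInd_le k Zs (box m (T m) setT) a) ->
  (forall Q, closed Q -> Q `<=` C -> fKInd_lt k (@closed X) Q c ->
     fKInd_lt k Zs (bundle Q (fun m => (T m `&` Q) `\` E m)) a) ->
  fKInd_le k Zs (bundle C T) a.
Proof.
move=> clC clT TC clTE KC KT Klt; case: Y0 => y0 _.
have [F0 FI FU] := @Zsat_lattice X Y M.
apply/fKInd_leP => A ZA AP A0.
have [B [clB AB BC Blt]] :
    separated (@closed X) C (fun i => [set x | A i (None, x, y0)]) c.
  move/fKInd_leP: KC; apply => [i|i x /AP//|].
    by apply: closed_at_X; exact: (ZA i).1.
  apply: set0_of_empty => x Ax; suff : (\bigcap_i A i) (None, x, y0) by rewrite A0.
  by move=> i _; exact: Ax.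
have BsC i : B i `<=` C by rewrite -BC => x Bx; exists i.
pose Q := \bigcap_i B i.
have clQ : closed Q by exact: closed_bigI.
have QC : Q `<=` C by move=> x /(_ ord0 I)/BsC.
(* The indices over which some [A i] meets the product of [B i] and [Y]. *)
pose F : set M := \bigcup_i [set m : M |
  exists2 p, (A i `&` @prX X Y M @^-1` B i) p & prA p = Some m].
have finF : finite_set F.
  apply: bigcup_finite => [|i _]; first exact: finite_finset.
  apply: finite_slices => //.
    apply: closedI; first exact: (ZA i).1.
    exact: closed_preimageT (@prX_continuous X Y M) (clB i).
  move=> p [Ap Bp] p0; suff : ([set x | A i (None, x, y0)] `&` B i) (prX p).
    by rewrite AB.
  by split => //; exact: ((ZA i).2 p).
pose T' m := [set x | T m x /\ ~ F m].
have clT' m : closed (T' m).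
  have [Fm|nFm] := pselect (F m).
    by rewrite (_ : T' m = set0); [exact: closed0|apply: set0_of_empty => x []].
  rewrite (_ : T' m = T m)//; apply/seteqP; split=> x; first by case.
  by split.
have T'C m : T' m `<=` C by move=> x [/TC].
have Zbox m : Zs (box m (T m) setT) by exact: Zsat_box.
have ZT' : Zs (bundle C T') by exact: Zsat_bundle.
have bE : bundle C T = (bundle C T' : set ZP) `|` \bigcup_(m in F) box m (T m) setT.
  apply/seteqP; split=> p; rewrite /bundle /=.
    case E0 : (prA p) => [m|] Tp; last by left.
    have [Fm|nFm] := pselect (F m); last by left.
    by right; exists m.
  case=> [|[m Fm [-> Tp _]]//].
  by case: (prA p) => [m []|].
rewrite bE; apply: separated_sum => //.
- exact: fam_bigcup.
- apply: set0_of_empty => p [+ [m Fm [pm _ _]]].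
  by rewrite /bundle /= pm => -[].
- by rewrite -bE.
- pose T'' i m := [set x | [/\ T' m x, B i x & i = ord0 -> ~ (E m x /\ Q x)]].
  have clT'' i m : closed (T'' i m).
    have -> : T'' i m = (T' m `&` B i) `&`
        (T m `\` [set x | [/\ i = ord0, E m x & Q x]]).
      apply/seteqP; split=> [x [Tx Bx nE]|x [[Tx Bx] [_ nE]]]; split => //.
        by split; [case: Tx|move=> [i0 Ex Qx]; apply: nE].
      by move=> i0 [Ex Qx]; apply: nE.
    apply: closedI; first exact: closedI.
    by apply: clTE => x [].
  exists (fun i => bundle (B i) (T'' i)); split=> [i|i||].
  + by apply: Zsat_bundle => // m x [].
  + apply: set0_of_empty => p [[Ap _]]; rewrite /bundle /=.
    case pE : (prA p) => [m|].
      move=> [[_ nFm] Bp _]; apply: nFm; exists i => //.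
      by exists p.
    move=> Bp; suff : ([set x | A i (None, x, y0)] `&` B i) (prX p) by rewrite AB.
    by split => //; exact: ((ZA i).2 p).
  + apply/seteqP; split=> p; rewrite /bundle /=.
      by move=> [i _] /=; case: (prA p) => [m []//|]; exact: BsC.
    have [i1 i10] : exists i : 'I_k.+1, i <> ord0.
      by exists ord_max => /(congr1 val) /= k0; move: k1; rewrite k0.
    case pE : (prA p) => [m|].
      move=> Tp; have [Qp|nQp] := pselect (Q (prX p)).
        by exists i1 => //=; rewrite pE; split => //; exact: Qp.
      have : C (prX p) by exact: T'C Tp.
      rewrite -BC => -[i _ Bp]; exists i => //=; rewrite pE; split => //.
      by move=> _ [].
    by rewrite -BC => -[i _ Bp]; exists i => //=; rewrite pE.
  + apply: fKInd_lt_sub (Klt Q clQ QC Blt) => //.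
      by apply: ZsatI => i; apply: Zsat_bundle => // m x [].
    move=> p Bp; rewrite /bundle /=; case pE : (prA p) => [m|]; last first.
      by move=> i _; have := Bp i I; rewrite /bundle /= pE.
    have Hp i : T'' i m (prX p) by have := Bp i I; rewrite /bundle /= pE.
    have Qp : Q (prX p) by move=> i _; case: (Hp i).
    have [[Tp _] _ nE] := Hp ord0; split; first by split.
    by move=> Ep; exact: nE.
- apply: separated_of_le => //; first exact: fam_bigcup.
  apply: fKInd_le_bigsum => //.
  by move=> m n _ _ [p [[+ _ _] [+ _ _]]] => -> [].
Qed.

(** Every point of a fiber with at most one point is isolated in it.  Hence the
partition can be chosen inside the slice over infinity, up to finitely many
slices, and passing from [C] to the bundle costs nothing. *)
Lemma fKInd_le_bundle1 (C : set X) (T : M -> set X) a :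
  closed C -> (forall m, T m `<=` C) ->
  (forall m x x', T m x -> T m x' -> x = x') ->
  fKInd_le k (@closed X) C a -> fKInd_le k (@closed Y) setT a ->
  fKInd_le k Zs (bundle C T) a.
Proof.
move=> clC TC T1 KC KY.
have TE m : T m = set0 \/ exists x, T m = [set x].
  have [[x Tx]|nT] := pselect (T m !=set0); [right|left].
    exists x; apply/seteqP; split=> [x' Tx'|_ -> //]; exact: T1 Tx.
  by apply: set0_of_empty => x Tx; apply: nT; exists x.
have clT m E : closed (T m `\` E).
  apply: closed_finite => //; apply: (@sub_finite_set _ _ (T m)); first by move=> x [].
  by case: (TE m) => [->|[x ->]]; [exact: finite_set0|exact: finite_set1].
apply: (fKInd_le_bundle (E := T) (c := a)) => //.
- by move=> m; rewrite -[T m]setD0.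
- move=> m; case: (TE m) => [->|[x ->]]; last exact/fKInd_le_box1.
  have -> : box m set0 setT = set0 :> set ZP by apply: set0_of_empty => p [].
  by apply: fKInd_le0; exact: Zsat0.
- move=> Q clQ QC Qlt; rewrite (_ : (fun m => _) = (fun=> set0)).
    exact/fKInd_lt_bundle0.
  by apply/funext => m; apply: set0_of_empty => x [[Tx _]].
Qed.

(** All points of [phi m] except its limit can be removed from the partition, which
then has fibers with at most one point. *)
Lemma fKInd_Z_upper (phi : M -> set X) a : (forall m, SX X (phi m)) ->
  fKInd_le k (@closed X) setT a -> fKInd_le k (@closed Y) setT a ->
  fKInd_le k Zs (bundle setT phi) (osucc a).
Proof.
move=> phiS KX KY.
have clphi m : closed (phi m) by have [] := SX_thin hX X0 (phiS m).
have [xi tphi] := choice (fun m => (SX_thin hX X0 (phiS m)).2).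
apply: (fKInd_le_bundle (E := fun m => phi m `\ xi m) (c := a)) => //.
- by move=> m E' E'E; apply: (thin_closedD hX (clphi m) (tphi m)) => /E'E[_]; apply.
- by move=> m; apply: fKInd_le_ord (ole_succ a) _; apply: fKInd_le_box (tphi m) _ KY.
- move=> Q clQ _ Qlt; apply: fKInd_lt_succ; apply: fKInd_le_bundle1 => //.
  + by move=> m x [[]].
  + move=> m x x' [[px _] nx] [[px' _] nx'].
    have eqxi z : phi m z -> ~ (phi m `\ xi m) z -> z = xi m.
      by move=> pz nz; apply: contrapT => zx; apply: nz.
    by rewrite (eqxi x) // (eqxi x').
  + by apply: fKInd_ltW => //; exact: closed0.
Qed.

End UpperBound.

(** * The lower bound *)

(** If a neighbourhood [W] of [x] missed the intersection of the [U j] with [j <> i],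
then adding [W] to [U i] would give a K-neighbourhood covering [x]. *)
Lemma Kobs_closure k (X : topologicalType) (U : 'I_k.+1 -> set X) x :
  open_Ktuple U -> Kobs U x ->
  (forall i, closure [set z | forall j, j <> i -> U j z] x) /\
  forall i, ~ U i x.
Proof.
move=> [U0 oU] obsx; split=> i.
- apply: contrapT => nclo.
  have [W [oW Wx] WU] : exists2 W, open W /\ W x &
      forall z, W z -> ~ forall j, j <> i -> U j z.
    have : nbhs x (~` [set z | forall j, j <> i -> U j z]).
      apply: contrapT => nn; apply: nclo => V nV.
      apply: contrapT => VU; apply: nn; apply: filterS nV => z Vz Uz.
      by apply: VU; exists z.
    by rewrite nbhsE => -[W [oW Wx] WU]; exists W.
  apply: obsx; exists (fun j => [set z | U j z \/ j = i /\ W z]); last first.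
    by exists i => //; right.
  split; last by move=> j z; left.
  split=> [|j].
  + apply: set0_of_empty => z Vz; have [Wz|nWz] := pselect (W z).
      by apply: (WU z Wz) => j ji; have [//|[]] := Vz j I.
    suff : (\bigcap_j U j) z by rewrite U0.
    by move=> j _; have [//|[]] := Vz j I.
  + have [->|ji] := pselect (j = i).
      rewrite (_ : [set z | _] = U i `|` W); first exact: openU.
      by apply/seteqP; split=> z [Uz|]; [left|case=> _; right|left|right].
    rewrite (_ : [set z | _] = U j) //.
    by apply/seteqP; split=> z; [case=> // -[]|left].
- move=> Uix; apply: obsx; exists U; last by exists i.
  exact: (conj (conj U0 oU) (fun j => @subset_refl _ (U j))).
Qed.

Section LowerBound.
Context (k : nat) (X Y : topologicalType) (M : choiceType) (phi : M -> set X).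
Hypothesis k1 : (1 <= k)%N.
Hypothesis cX : compact [set: X].
Hypothesis hX : hausdorff_space X.
Hypothesis Y0 : [set: Y] !=set0.
Hypothesis cY : compact [set: Y].
Hypothesis hY : hausdorff_space Y.
Hypothesis XF : Frechet X.
Hypothesis weightX : weight_lt X M.
Hypothesis fibers : forall S, SX X S -> (phi @^-1` [set S] #= [set: M])%card.
Local Notation ZP := (Zprod X Y M).
Local Notation Zs := (@Zsat X Y M).

(** If Z had dimension at most [a], a copy of [Y] would be contained in a partition of
smaller dimension: the copy over [x] in the slice over a suitable [m], where [x] is
an obstruction point and [phi m] consists of [x] and of sequences converging to it
inside the intersections of all but one of the [U j]. *)
Lemma fKInd_Z_lower (A : 'I_k.+1 -> set X) a : closed_Ktuple A ->
  (forall U, Knbhd A U -> fKInd_lt k (@closed X) (~` \bigcup_i U i) a ->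
     Kobs U !=set0) ->
  fKInd_le k Zs (bundle setT phi) a ->
  exists2 b, olt b a & fKInd_le k (@closed Y) setT b.
Proof.
move=> [A0 clA] bad /fKInd_leP KZ; case: (Y0) => y0 _.
have ZA i : Zs (bundle (A i) (fun=> set0)).
  by apply: Zsat_bundle => // m; [exact: closed0|exact: sub0set].
have [i p||B [ZB AB BZ Blt]] := KZ (fun i => bundle (A i) (fun=> set0)) ZA.
- by rewrite /bundle /=; case: (prA p).
- apply: set0_of_empty => p Ap; suff : (\bigcap_i A i) (prX p) by rewrite A0.
  by move=> i _; have := Ap i I; rewrite /bundle /=; case: (prA p).
pose U i := ~` [set x | B i (None, x, y0)].
have BU i p : B i p -> prA p = None -> ~ U i (prX p).
  by move=> Bp p0; apply; exact: ((ZB i).2 p).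
have UA : Knbhd A U.
  split; [split|].
  - apply: set0_of_empty => x Ux.
    have : (bundle setT phi) ((None, x, y0) : ZP) by [].
    by rewrite -BZ => -[i _ Bx]; exact: Ux Bx.
  - by move=> i; apply: closed_openC; apply: closed_at_X; exact: (ZB i).1.
  - move=> i x Ax Bx.
    suff : (bundle (A i) (fun=> set0) `&` B i) ((None, x, y0) : ZP) by rewrite AB.
    by [].
have [||x /(Kobs_closure UA.1)[clx nUx]] := bad U => //.
  apply/(@fKInd_lt_bundle0 k X Y M) => //.
  apply: fKInd_lt_sub Blt.
  - exact: ZsatI.
  - apply: Zsat_bundle => // m; [|exact: closed0|exact: sub0set].
    apply: open_closedC; apply: bigcup_open => i _; exact: UA.1.2.
  - move=> p; rewrite /bundle /=; case pE : (prA p) => [//|] nU i _.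
    apply: contrapT => nB; apply: nU; exists i => // Bx; apply: nB.
    exact: ((ZB i).2 _ p Bx).
have /choice[u uP] i : exists v : nat -> X,
    (forall n j, j <> i -> U j (v n)) /\ v @ \oo --> x.
  by have [v vU vx] := XF (clx i); exists v.
(* The isolated points of the future member of S_X. *)
pose R := \bigcup_i range (u i).
have other (i : 'I_k.+1) : exists j, j <> i.
  have [->|i0] := pselect (i = ord0); last by exists ord0 => /esym.
  by exists ord_max => /(congr1 val) /= k0; move: k1; rewrite k0.
have nRx : ~ R x.
  move=> [i _ [n _ ux]]; have [j ji] := other i.
  by apply: (nUx j); rewrite -ux; exact: (uP i).1.
have tR : thin R x.
  move=> W oW Wx; rewrite /R setD_bigcupl.
  apply: bigcup_finite => [|i _]; first exact: finite_finset.
  have [N _ NW] : \forall n \near \oo, W (u i n).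
    by apply: (uP i).2; exact: open_nbhs_nbhs.
  apply: sub_finite_set (finite_image (u i) (finite_II N)) => _ [[n _ <-] nW].
  exists n => //=; rewrite ltnNge; apply/negP => Nn; apply: nW; exact: NW.
have infR : ~ finite_set R.
  move=> finR; have : nbhs x (~` R).
    by apply: open_nbhs_nbhs; split => //; apply: closed_openC; exact: closed_finite.
  move/((uP ord0).2) => [N _ /(_ N (leqnn N))]; apply.
  by exists ord0 => //; exists N.
have cR : countable R.
  apply: bigcup_countable => [|i _]; first exact: finite_set_countable finite_finset.
  exact: card_image_le.
have SXR := SX_of_thin hX tR cR infR nRx.
(* Each relation [U j s] excludes finitely many [m], and [R] is countable. *)
have [m [phim mgood]] : exists m, phi m = x |` R /\
    forall s j y, R s -> U j s -> ~ B j (Some m, s, y).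
  apply: contrapT => nm; apply: (thin_uncountable hX tR infR nRx weightX).
  have := fibers SXR; rewrite card_eq_le => /andP[_ /sub_countable]; apply.
  apply: (@sub_countable _ _ _ (\bigcup_(s in R) \bigcup_(j in [set j | U j s])
    [set m | exists2 p, (B j `&` @prX X Y M @^-1` [set s]) p & prA p = Some m])).
    apply: subset_card_le => m /= pm.
    apply: contrapT => nbad; apply: nm; exists m; split => // s j y Rs Us By.
    by apply: nbad; exists s => //; exists j => //; exists (Some m, s, y).
  apply: bigcup_countable => // s Rs; apply: bigcup_countable => [|j Us].
    exact: finite_set_countable finite_finset.
  apply: finite_set_countable; apply: finite_slices => //.
    apply: closedI; first exact: (ZB j).1.
    by apply: closed_preimageT; [exact: prX_continuous|exact: closed_point].
  by move=> p [Bp ps] p0; apply: (BU j p Bp p0); rewrite (ps : prX p = s).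
suff: fKInd_lt k Zs (box m [set x] setT) a.
  case=> [box0|[b ba /fKInd_le_box1 Kb]]; last by exists b => //; exact: Kb.
  by suff : box m [set x] setT ((Some m, x, y0) : ZP) by rewrite box0.
apply: fKInd_lt_sub Blt.
- exact: ZsatI.
- by apply: Zsat_box => //; exact: closed_point.
move=> [[pA pX] y] [/= pm px _] i _; rewrite /prA/prX/= in pm px.
rewrite pm px.
have clBi : closed [set z | B i (Some m, z, y)].
  by apply: closed_at_X; exact: (ZB i).1.
apply: (closed_cvg _ clBi _ x (uP i).2); apply: nearW => n.
have Rn : R (u i n) by exists i => //; exists n.
have : bundle setT phi ((Some m, u i n, y) : ZP) by rewrite /bundle /= phim; right.
rewrite -BZ => -[j _ Bj].
(* Otherwise [u i n] is in [U j], and [B j] would meet its fiber over [m]. *)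
have [ij|ji] := pselect (j = i); first by move: Bj; rewrite ij.
by have := mgood _ j y Rn ((uP i).1 n j ji).
Qed.

End LowerBound.

(** * The value of K-Ind Z *)

Lemma KInd_DimOrd k (Z : topologicalType) a : KInd k Z = DimOrd a ->
  KInd_le k Z a /\ forall b, KInd_le k Z b -> ole a b.
Proof.
rewrite /KInd; case: pselect => [//|nZ0]; case: pselect => [h|//] /=.
by case: cid => b /= [Zb bmin] [<-].
Qed.

Lemma KInd_eq_DimOrd k (Z : topologicalType) a :
  [set: Z] !=set0 -> KInd_le k Z a ->
  (forall b, KInd_le k Z b -> ole a b) -> dim_eq (KInd k Z) (DimOrd a).
Proof.
move=> [z _] Za amin; rewrite /KInd; case: pselect => [Z0|nZ0].
  by exfalso; suff : (set0 : set Z) z by []; rewrite -Z0.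
case: pselect => [h|[]]; last by exists a.
by case: cid => b [Zb bmin] /=; split; [exact: bmin|exact: amin].
Qed.

Lemma KStr1P k (X : topologicalType) : KStr k X = 1%N ->
  exists2 a, KInd k X = DimOrd a &
  exists2 A : 'I_k.+1 -> set X, closed_Ktuple A &
    forall U, Knbhd A U -> fKInd_lt k (@closed X) (~` \bigcup_i U i) a ->
    Kobs U !=set0.
Proof.
rewrite /KStr; case E : (KInd k X) => [|a|] //.
case: asboolP => // _; case: asboolP => // /existsNP[A /not_implyP[clA nU]] _.
exists a => //; exists A => // U AU Ult.
apply: contrapT => /set0P/negP/negPn/eqP obs0.
apply: nU; exists U; split => //; apply/dim_lt_KInd.
have clU : closed (~` \bigcup_i U i).
  by apply: open_closedC; apply: bigcup_open => i _; exact: AU.1.2.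
case: Ult => [->|[b ba Kb]]; [left|right].
  by apply: set0_of_empty => x _; exact: (set_mem (valP x)).
by exists b => //; apply/KInd_le_closedE.
Qed.

Theorem theorem5p7 (k : nat) (X Y : topologicalType)
    (M : choiceType) (phi : M -> set X) :
  (1 <= k)%N ->
  [set: X] !=set0 -> compact [set: X] -> hausdorff_space X ->
  [set: Y] !=set0 -> compact [set: Y] -> hausdorff_space Y ->
  Frechet X ->
  KStr k X = 1%N ->
  dim_eq (KInd k X) (KInd k Y) ->
  Z_parameters Y phi ->
  dim_eq (KInd k (Zspace Y phi)) (dim_succ (KInd k X)).
Proof.
move=> k1 X0 cX hX Y0 cY hY XF /KStr1P[a Xa [A clA bad]].
rewrite Xa; case Yb : (KInd k Y) => [|b|] // [ab ba] [_ weightX _ _ phiS fib].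
have [/KInd_leE KX minX] := KInd_DimOrd Xa.
have [/KInd_leE KYb minY] := KInd_DimOrd Yb.
have KY := fKInd_le_ord ba KYb.
have clphi m : closed (phi m) by have [] := SX_thin hX X0 (phiS m).
apply: KInd_eq_DimOrd.
- have [[x _] [y _]] := (X0, Y0).
  have Zx : (\bigcup_c @Zslice X Y M phi c) (Zpi (None, x, y)).
    by exists None => //; exists (None, x, y).
  by exists (SigSub (mem_set Zx)).
- by apply/KInd_le_ZspaceE => //; exact: fKInd_Z_upper.
- move=> c /KInd_le_ZspaceE KZ; have [//|ca] := ole_total (osucc a) c.
  have {}ca : ole c a by case: ca.
  have [d da /KInd_leE/minY bd] :
      exists2 d, olt d a & fKInd_le k (@closed Y) setT d.
    apply: (fKInd_Z_lower (phi := phi) _ _ _ _ _ _ _ _ _ clA bad) => //.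
    by apply: fKInd_le_ord ca _; exact: KZ.
  by case: (olt_irr (olt_le_trans da (ole_trans ab bd))).
Qed.
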